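(* Let $a,b$ be positive integers, let $R=\dfrac{a+\sqrt{a^2+4b}}{2}$, and let $(f[n])_{n\ge 1}$ be defined by $f[1]=f[2]=1$ and $f[n]=a f[n-1]+b f[n-2]$ for $n\ge 3$. For each positive integer $N$ let $\underline{X}=\underline{X}_N$ be a random variable with values in $\{1,\dots,N\}$ and $P(\underline{X}_N=n)=\dfrac{f[N+1-n]}{\sum_{k=1}^{N}f[k]}$ for $1\le n\le N$. Then $$\lim_{N\to\infty}E(\underline{X}_N)=\frac{R}{R-1}.$$
   Context: $E$ denotes expectation. $R$ is the positive real root of the characteristic equation $r^2-ar-b=0$ of the recurrence. *)

(* Defs.v *)
From HB Require Import structures.
From mathcomp Require Export all_boot all_order all_algebra.
From mathcomp Require Export all_classical all_reals all_analysis.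
Export Order.TTheory GRing.Theory Num.Theory.
Export numFieldNormedType.Exports.

Set Implicit Arguments.
Unset Strict Implicit.
Unset Printing Implicit Defensive.

(* Main.v *)
(** Scaling by powers of [r], everything follows from one fact: if
    x_(n+1) = q x_n + g_n with |q| < 1 and g_n -> l, then x_n -> l / (1 - q).
    As -b/r is the other characteristic root, f[n+1] + (b/r) f[n] is geometric of
    ratio [r], so f[n] / r^n satisfies such a recurrence with q = -b/r^2.  Its
    partial sums S_n, and then the partial sums V_n of S_n, again scaled by r^n,
    satisfy such recurrences with q = 1/r.  Since E(X_N) = V_N / S_N, the ratio of
    the last two limits is 1 / (1 - 1/r) = r / (r - 1). *)
Require Import Defs.
From HB Require Import structures.
From mathcomp Require Import all_boot all_order all_algebra.
From mathcomp Require Import all_classical all_reals all_analysis.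
From mathcomp Require Import measurable_realfun ring lra.
Import Order.TTheory GRing.Theory Num.Theory.
Import numFieldNormedType.Exports.

Local Open Scope classical_set_scope.
Local Open Scope ring_scope.

Lemma cvg0_affine_rec (R : realType) (q : R) (x g : nat -> R) :
  `|q| < 1 -> (forall n, x n.+1 = q * x n + g n) ->
  g n @[n --> \oo] --> 0 -> x n @[n --> \oo] --> 0.
Proof.
move=> q1 xE g0; apply/cvgrPdist_lt => e e0.
(* With this threshold for [g], [e / 2] is the fixed point of the bounding map that multiplies by
   [|q|] and adds the threshold, so the bound [xN] carries over from [k] to [k + 1]. *)
have d0 : 0 < e / 2 * (1 - `|q|) by rewrite mulr_gt0 ?subr_gt0// divr_gt0.
have [N _ gN] := (@cvgrPdist_lt _ _ _ _ _ _ _).1 g0 _ d0.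
have xN k : `|x (k + N)%N| <= `|q| ^+ k * `|x N| + e / 2.
  elim: k => [|k IH]; first by rewrite expr0 mul1r lerDl divr_ge0// ltW.
  have := gN (k + N)%N (leq_addl _ _); rewrite /= sub0r normrN => gkN.
  rewrite addSn xE (le_trans (ler_normD _ _))// normrM exprS.
  have := ler_wpM2l (normr_ge0 q) IH; lra.
have : `|q| ^+ k * `|x N| @[k --> \oo] --> 0.
  have := @cvg_expr _ `|q|; rewrite normr_id => /(_ q1) q0.
  by have := cvgM q0 (cvg_cst `|x N|); rewrite mul0r; exact.
move=> /cvgrPdist_lt/(_ (e / 2)) []; first by rewrite divr_gt0.
move=> M _ hM; exists (M + N)%N => // n /= MNn.
have Nn : (N <= n)%N by rewrite (leq_trans _ MNn)// leq_addl.
have := hM (n - N)%N; rewrite /= leq_subRL// addnC => /(_ MNn).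
rewrite !sub0r !normrN ger0_norm ?mulr_ge0 ?exprn_ge0// => h.
by have := xN (n - N)%N; rewrite subnK//; lra.
Qed.

(** [l / (1 - q)] is the fixed point of the limiting recurrence; subtracting it from [x] leaves the
    same recurrence with [g - l], which tends to 0. *)
Lemma cvg_affine_rec (R : realType) (q l : R) (x g : nat -> R) :
  `|q| < 1 -> (forall n, x n.+1 = q * x n + g n) ->
  g n @[n --> \oo] --> l -> x n @[n --> \oo] --> l / (1 - q).
Proof.
move=> q1 xE gl; apply/subr_cvg0.
have q'0 : 1 - q != 0.
  by rewrite subr_eq0 eq_sym; apply: contraTneq q1 => ->; rewrite normr1 ltxx.
apply: (@cvg0_affine_rec _ q _ (fun n => g n - l)) => // [n|].
  by rewrite /= xE; field.
exact/subr_cvg0.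
Qed.

Lemma cvg_geometric_partial_sums (R : realType) (r l : R) (F : nat -> R) :
  1 < r -> F n / r ^+ n @[n --> \oo] --> l ->
  (\sum_(k < n.+1) F k) / r ^+ n @[n --> \oo] --> l / (1 - r^-1).
Proof.
move=> r1 Fl; have r0 : 0 < r by exact: lt_trans r1.
apply: (@cvg_affine_rec _ r^-1 _ _ (fun n => F n.+1 / r ^+ n.+1)).
- by rewrite ger0_norm ?invr_ge0 ?ltW// invf_lt1.
- move=> n; rewrite big_ord_recr/= mulrDl; congr (_ + _).
  by rewrite exprS invfM; ring.
- by rewrite (cvg_shiftS (fun n => F n / r ^+ n)).
Qed.

(** [F j] occurs in the inner sums for [m] from [j] to [n], hence [n - j + 1] times. This turns the
    numerator of the expectation into iterated partial sums. *)
Lemma sum_linear_weights (R : nzRingType) (F : nat -> R) (n : nat) :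
  \sum_(k < n.+1) k.+1%:R * F (n - k)%N =
  \sum_(m < n.+1) \sum_(k < m.+1) F k.
Proof.
elim: n => [|n IH]; first by rewrite !big_ord1 mul1r.
have revE : \sum_(k < n.+1) F (n - k)%N = \sum_(k < n.+1) F k.
  rewrite [RHS](reindex_inj rev_ord_inj)/=.
  by apply: eq_bigr => k _; rewrite subSS.
(* The term [k = 0] is [F n.+1]; every later weight exceeds its counterpart in [IH] by one, and this
   surplus together with [F n.+1] is the new inner sum. *)
rewrite big_ord_recl [RHS]big_ord_recr/= -IH [X in _ = _ + X]big_ord_recr/= -revE.
rewrite mul1r subn0 addrA -big_split/= [RHS]addrC; congr (_ + _).
by apply: eq_bigr => k _; rewrite /bump add1n subSS -natr1 mulrDl mul1r.
Qed.

(** [X] is pointwise a finite sum of constants times indicators of its level sets, which is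
    integrated term by term. *)
Lemma expectation_nat_valued (d : measure_display) (T : measurableType d)
    (R : realType) (P : probability T R) (X : {RV P >-> R}) (N : nat) :
  (forall w, exists2 n, (n < N)%N & X w = n%:R) ->
  ('E_P[X] = \sum_(n < N) n%:R%:E * P [set w | X w = n%:R])%E.
Proof.
move=> XN; rewrite unlock.
have mA n : measurable [set w | X w = n%:R].
  exact: (measurable_funPTI X (measurable_set1 (n%:R : R))).
under eq_integral => w _.
  rewrite (_ : (X w)%:E =
    \sum_(n < N) (n%:R%:E * (\1_[set w | X w = n%:R] w)%:E)%E); last first.
    have [m mN Xw] := XN w.
    rewrite (bigD1 (Ordinal mN))//= indicE mem_set// mule1 big1 ?adde0 ?Xw//.
    move=> i /eqP iN; rewrite indicE memNset ?mule0//= Xw => /eqP.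
    by rewrite eqr_nat => /eqP mi; apply: iN; apply: val_inj.
  over.
rewrite ge0_integral_sum//; last first.
  move=> n; apply: measurable_funeM.
  by apply/measurable_EFinP; exact: measurable_indic.
apply: eq_bigr => n _; rewrite ge0_integralZl_EFin//.
- by rewrite integral_indic ?setIT.
- by apply/measurable_EFinP; exact: measurable_indic.
Qed.

Lemma cvg_linear_rec2 (R : realType) (a b r : R) (F : nat -> R) :
  0 < a -> 0 < b -> 0 < r -> r ^+ 2 = a * r + b ->
  (forall n, F n.+2 = a * F n.+1 + b * F n) ->
  F n / r ^+ n @[n --> \oo] --> (F 1%N + b / r * F 0%N) / r / (1 + b / r ^+ 2).
Proof.
move=> a0 b0 r0 rE FE.
have geo n : F n.+1 + b / r * F n = (F 1%N + b / r * F 0%N) * r ^+ n.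
  elim: n => [|n IH]; first by rewrite expr0 mulr1.
  rewrite FE.
  (* The roots [r] and [- b / r] add up to [a]. *)
  have -> : a = r - b / r.
    by apply: (mulIf (lt0r_neq0 r0)); rewrite mulrBl divfK ?gt_eqF//
      -expr2 rE addrK.
  by rewrite exprSr mulrA -IH; field; rewrite gt_eqF.
rewrite -[X in 1 + X]opprK.
apply: (@cvg_affine_rec _ _ _ _ (fun=> (F 1%N + b / r * F 0%N) / r)).
(* The ratio has modulus [b / r ^+ 2], below 1 because [r ^+ 2 = a * r + b] exceeds [b]. *)
- rewrite normrN ger0_norm ?divr_ge0 ?exprn_ge0 ?ltW// ltr_pdivrMr ?exprn_gt0//.
  by rewrite mul1r rE ltrDr mulr_gt0.
- move=> n; have -> : F n.+1 = (F 1%N + b / r * F 0%N) * r ^+ n - b / r * F n.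
    by rewrite -geo addrK.
  rewrite exprS; field.
  by rewrite expf_neq0 gt_eqF.
- exact: cvg_cst.
Qed.

Theorem theorem4p3 (R : realType) (a b : nat) (a_gt0 : (0 < a)%N) (b_gt0 : (0 < b)%N)
  (f : nat -> nat) (f1 : f 1%N = 1%N) (f2 : f 2%N = 1%N)
  (fE : forall n : nat, (3 <= n)%N -> f n = (a * f (n - 1) + b * f (n - 2))%N)
  (d : nat -> measure_display) (T : forall N : nat, measurableType (d N))
  (P : forall N : nat, probability (T N) R)
  (X : forall N : nat, {RV (P N) >-> R})
  (X_values : forall N : nat, (0 < N)%N -> forall w : T N,
     exists2 n : nat, (1 <= n <= N)%N & X N w = n%:R)
  (X_law : forall N : nat, (0 < N)%N -> forall n : nat, (1 <= n <= N)%N ->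
     P N [set w : T N | X N w = n%:R] =
       ((f (N + 1 - n)%N)%:R / \sum_(1 <= k < N.+1) (f k)%:R)%:E) :
  let r : R := (a%:R + Num.sqrt (a%:R ^+ 2 + 4 * b%:R)) / 2 in
  ('E_(P N)[X N])%E @[N --> \oo] --> (r / (r - 1))%:E.
Proof.
move=> r.
have a1 : 1 <= a%:R :> R by rewrite ler1n.
have b1 : 1 <= b%:R :> R by rewrite ler1n.
have b0 : 0 < b%:R :> R by rewrite ltr0n.
have rE : r ^+ 2 = a%:R * r + b%:R.
  have : Num.sqrt (a%:R ^+ 2 + 4 * b%:R) ^+ 2 = a%:R ^+ 2 + 4 * b%:R :> R.
    by rewrite sqr_sqrtr// addr_ge0 ?sqr_ge0// mulr_ge0.
  rewrite /r; set s := Num.sqrt _ => sE.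
  have -> : b%:R = (s ^+ 2 - a%:R ^+ 2) / 4 :> R by rewrite sE; field.
  by field.
have r0 : 0 < r by rewrite divr_gt0// ltr_pwDl ?sqrtr_ge0// ltr0n.
clearbody r.
have r1 : 1 < r by nra.
pose F n : R := (f n.+1)%:R.
pose S n : R := \sum_(k < n.+1) F k.
have FE n : F n.+2 = a%:R * F n.+1 + b%:R * F n.
  by rewrite /F fE// !subSS !subn0 natrD !natrM.
have Ec n : ('E_(P n.+1)[X n.+1])%E = ((\sum_(m < n.+1) S m) / S n)%:E.
  rewrite (@expectation_nat_valued _ _ _ _ _ n.+2); last first.
    by move=> w; have [m /andP[_ mn] ->] := X_values n.+1 isT w; exists m.
  (* The value 0, about which [X_law] says nothing, has weight 0 and drops out. *)
  rewrite big_ord_recl mul0e add0e -sum_linear_weights mulr_suml -sumEFin.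
  apply: eq_bigr => k _; rewrite lift0 X_law ?ltn_ord//.
  rewrite -EFinM addn1 subSS subSn; last by rewrite -ltnS ltn_ord.
  by rewrite mulrA big_add1 big_mkord.
set c := (F 1%N + b%:R / r * F 0%N) / r / (1 + b%:R / r ^+ 2).
(* Positivity of [c] makes the limit of the scaled [S n] nonzero, so that the quotient of limits may
   be taken. *)
have c0 : 0 < c.
  rewrite /c /F f1 f2 mulr1 divr_gt0// ?divr_gt0//.
    by rewrite addr_gt0// divr_gt0.
  by rewrite addr_gt0// divr_gt0// exprn_gt0.
have Fc : F n / r ^+ n @[n --> \oo] --> c.
  by apply: (@cvg_linear_rec2 _ a%:R) => //; lra.
have Sc := cvg_geometric_partial_sums _ _ _ _ r1 Fc.
have Vc := cvg_geometric_partial_sums _ _ _ _ r1 Sc.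
have ri0 : 0 < 1 - r^-1 by rewrite subr_gt0 invf_lt1.
have lS0 : c / (1 - r^-1) != 0 by rewrite gt_eqF// divr_gt0.
have VSc : (\sum_(m < n.+1) S m) / S n @[n --> \oo] --> r / (r - 1).
  have -> : r / (r - 1) = c / (1 - r^-1) / (1 - r^-1) / (c / (1 - r^-1)).
    by field; rewrite !gt_eqF//; lra.
  rewrite [X in X @ \oo](_ : _ = (fun n =>
    (\sum_(m < n.+1) S m) / r ^+ n * (S n / r ^+ n)^-1)).
    exact: (cvgM Vc (cvgV lS0 Sc)).
  apply/funext => n; rewrite invfM invrK mulrACA mulVf ?mulr1//.
  by rewrite expf_neq0// gt_eqF.
(* [Ec] computes the expectation from [N = 1] on, so the limit is taken along [N = n + 1]. *)
rewrite -(cvg_shiftS (fun N => 'E_(P N)[X N])%E).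
under eq_fun do rewrite Ec.
by apply: cvg_EFin; [exact: nearW | exact: VSc].
Qed.
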